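(* Let $s \ge 3$ and suppose there exist an $(n, d(F), \lambda(F))$-graph $F$ and an $(n, d(G), \lambda(G))$-graph $G$ on the same vertex set $V$ such that the pair $(F,G)$ is $H_s$-free. Let \[ \eta = \max\left\{ \frac{\lambda(G)^2}{d(G)^2}, \frac{\lambda(F)\lambda(G)}{d(F)d(G)} \right\}, \qquad w = \frac{4 n \log n}{d(G)}. \] Then for every positive integer $k$ with $w \le k \le \eta\, d(F)\, n$, \[ r(s,k) \ge \frac{1}{50} k\, \eta^{\frac{w-k}{k}} - 1. \] In particular, if $\eta\, d(F)\, n \ge k \ge 100 n (\log n)^2 / d(G)$, then \[ r(s,k) \ge \frac{k}{100\eta} - 1. \]
   Context: Graphs may have loops (at most one per vertex); in the adjacency matrix a loop is a $1$ on the diagonal and contributes one to the degree. A graph is an $(n,d,\lambda)$-graph if it has $n$ vertices, is $d$-regular, and all eigenvalues of its adjacency matrix other than the largest one (which equals $d$) are at most $\lambda$ in absolute value. An ordered pair of graphs $(F,G)$ on the same vertex set is $H_s$-free if there is no $2s$-tuple of (not necessarily distinct) vertices $(a_1,b_1,\dots,a_s,b_s)$ with $a_ib_i \in E(F)$ for all $i\in[s]$ and $a_ib_j \in E(G)$ for all $1 \le i < j \le s$ (an edge $aa$ means a loop). The Ramsey number $r(s,k)$ is the minimum $N$ such that every graph on $N$ vertices contains a clique of size $s$ or an independent set of size $k$. $\log$ is the natural logarithm. *)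

(* Defs.v *)
From HB Require Import structures.
From mathcomp Require Import all_boot all_order all_algebra.
From mathcomp Require Import reals exp.
Set Implicit Arguments. Unset Strict Implicit. Unset Printing Implicit Defensive.
Import Order.TTheory GRing.Theory Num.Theory.
Local Open Scope ring_scope.

(* A graph on vertex set 'I_n (possibly with loops, at most one per vertex)
   is a symmetric relation e; e i i means a loop at i. *)

Definition adjmx (R : nzRingType) (n : nat) (e : rel 'I_n) : 'M[R]_n :=
  \matrix_(i, j) (e i j)%:R.

Definition regular (n : nat) (e : rel 'I_n) (d : nat) : Prop :=
  forall i : 'I_n, #|[set j | e i j]| = d.

(* (n,d,lambda)-graph: symmetric, d-regular, and the eigenvalues of the
   adjacency matrix (roots of its characteristic polynomial, counted with
   multiplicity), with one copy of the largest eigenvalue d removed, are all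
   at most lambda in absolute value.  (The adjacency matrix is real
   symmetric, so all its eigenvalues are real.) *)
Definition ndl_graph (R : realType) (n d : nat) (lam : R) (e : rel 'I_n) : Prop :=
  [/\ symmetric e, regular e d &
      exists q : {poly R},
        char_poly (adjmx R e) = ('X - (d%:R)%:P) * q /\
        (forall x : R, root q x -> `|x| <= lam)].

Definition Hs_free (n s : nat) (F G : rel 'I_n) : Prop :=
  ~ exists a b : 'I_s -> 'I_n,
      (forall i, F (a i) (b i)) /\
      (forall i j : 'I_s, (i < j)%N -> G (a i) (b j)).

Definition ramsey_prop (s k N : nat) : Prop :=
  forall e : rel 'I_N, irreflexive e -> symmetric e ->
    exists S : {set 'I_N},
      (#|S| = s /\ {in S &, forall x y, x != y -> e x y}) \/
      (#|S| = k /\ {in S &, forall x y, x != y -> ~~ e x y}).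

(* r(s,k) >= x, where r(s,k) = min { N | ramsey_prop s k N } *)
Definition ramsey_ge (R : realType) (s k : nat) (x : R) : Prop :=
  forall N : nat, ramsey_prop s k N -> x <= N%:R.

(* Main.v *)
Require Import Defs.
From HB Require Import structures.
From mathcomp Require Import all_boot all_order all_algebra.
From mathcomp Require Import reals sequences exp complex ring lra.
Set Implicit Arguments. Unset Strict Implicit. Unset Printing Implicit Defensive.
Import Order.TTheory GRing.Theory Num.Theory.
Local Open Scope ring_scope.

(** Let [U] be the set of ordered pairs [(a, b)] with [ab] an edge of [F]. A sequence
[(x_1, ..., x_N)] in [U] defines a graph on the indices, where [i < j] are adjacent iff the first
vertex of [x_i] is [G]-adjacent to the second vertex of [x_j]. This graph has no clique of size
[s] because [(F, G)] is [H_s]-free, so it suffices that some sequence yields no independent set of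
size [k].

The pairs of an independent set are picked in order; keep track of the set [B] of vertices not
[G]-adjacent to any earlier first vertex, to which the next second vertex must belong. Either the
new first vertex has at least [c |B|] neighbours in [B], with [c = d(G) / 2n], and then [B]
shrinks by the factor [1 - c]; or it is one of the few remaining vertices, and by the expander
mixing lemma for [G] and then for [F] there are at most [6 eta |U|] such pairs. With
[rho = 6 eta], the number of ways to continue from [B] for [k] more steps is thus at most
[(2 rho |U|)^k rho^-(1 + ln |B| / c)], and the union bound over the [k]-subsets of the indices
gives the first inequality when [eta < 1/50]. When [eta >= 1/50] the bound is below [k], and the
empty graph does the job. The second inequality follows since [eta >= n^-2]. *)

(** * Symmetric matrices whose characteristic polynomial has a known root *)

Section Spectral.
Local Open Scope sesquilinear_scope.

(** A unitary change of basis diagonalizes [A], and conjugation leaves the characteristic polynomial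
    unchanged. *)
Lemma char_poly_spectral (C : numClosedFieldType) n (A : 'M[C]_n) :
  A \is hermsymmx -> char_poly A = \prod_i ('X - (spectral_diag A 0 i)%:P).
Proof.
move=> /hermitian_normalmx/orthomx_spectralP A_eq.
set P := spectralmx A in A_eq *; set D := spectral_diag A in A_eq *.
have Punit : P \in unitmx by apply: spectral_unit.
transitivity (char_poly (diag_mx D)); last first.
  rewrite char_poly_trig ?diag_mx_is_trig //.
  by apply: eq_bigr => i _; rewrite mxE eqxx mulr1n.
rewrite /char_poly /char_poly_mx.
have PP : map_mx polyC (invmx P) *m map_mx polyC P = 1%:M.
  by rewrite -map_mxM mulVmx // map_mx1.
rewrite -(mulr1 (\det ('X%:M - map_mx polyC (diag_mx D)))) -(det1 _ n) -PP.
rewrite det_mulmx mulrCA mulrA -!det_mulmx; congr (\det _).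
rewrite {1}A_eq 2!map_mxM.
by rewrite mulmxBr mulmxBl scalar_mxC -(mulmxA 'X%:M) PP mulmx1.
Qed.

(** In an orthonormal eigenbasis, [A] scales each coordinate of [x] by an eigenvalue, so it suffices
    that every eigenvalue at a nonzero coordinate of [x] is a root of [q]. *)
Lemma hermitian_quotient_bound (C : numClosedFieldType) n (A : 'M[C]_n) (d lam : C)
    (q : {poly C}) (u x : 'rV[C]_n) :
  A \is hermsymmx -> char_poly A = ('X - d%:P) * q ->
  (forall z, root q z -> `|z| <= lam) ->
  u != 0 -> u *m A = d *: u -> x *m u^t* = 0 ->
  \sum_i `|(x *m A) 0 i| ^+ 2 <= lam ^+ 2 * \sum_i `|x 0 i| ^+ 2.
Proof.
move=> Aherm charA qlam u0 uA xu.
have norm2E (y : 'rV[C]_n) : \sum_i `|y 0 i| ^+ 2 = (y *m y^t*) 0 0.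
  by rewrite mxE; apply: eq_bigr => i _; rewrite !mxE normCK.
have normU (P : 'M[C]_n) (y : 'rV[C]_n) : P \is unitarymx ->
    \sum_i `|(y *m P) 0 i| ^+ 2 = \sum_i `|y 0 i| ^+ 2.
  move=> Pu; rewrite !norm2E trmx_mul map_mxM mulmxA.
  by rewrite (mulmxtVK _ Pu).
have /orthomx_spectralP A_eq := hermitian_normalmx Aherm.
have Pu := spectral_unitarymx A; have Punit := spectral_unit A.
have charE := char_poly_spectral Aherm.
set P := spectralmx A in A_eq Pu Punit *; set D := spectral_diag A in A_eq charE *.
have [v vE] : exists v : 'rV_n -> 'rV_n, forall y, y = v y *m P.
  by exists (fun y => y *m invmx P) => y; rewrite mulmxKV.
have vA y : y *m A = (v y *m diag_mx D) *m P by rewrite {1}A_eq {1}(vE y) !mulmxA mulmxK.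
have vD y i : (v y *m diag_mx D) 0 i = v y 0 i * D 0 i.
  rewrite mxE (bigD1 i) //= big1 => [|j ji].
    by rewrite addr0 [diag_mx _ _ _]mxE eqxx mulr1n.
  by rewrite [diag_mx _ _ _]mxE (negbTE ji) mulr0n mulr0.
(* An eigenvector for [d] has nonzero coordinates only at eigenvalues equal to [d]. *)
have vu i : v u 0 i != 0 -> D 0 i = d.
  move=> ui; apply: (mulfI ui); rewrite -vD.
  have : v u *m diag_mx D *m P = (d *: v u) *m P by rewrite -vA uA -scalemxAl -vE.
  by move/(can_inj (mulmxK Punit)) ->; rewrite [LHS]mxE mulrC.
have vxu : \sum_i v x 0 i * (v u 0 i)^* = 0.
  have : v x *m (v u)^t* = 0.
    by rewrite -xu [in RHS](vE x) [in RHS](vE u) trmx_mul map_mxM mulmxA (mulmxtVK _ Pu).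
  move/matrixP/(_ 0 0) => vv; transitivity ((v x *m (v u)^t*) 0 0); last by rewrite vv mxE.
  by rewrite [RHS]mxE; apply: eq_bigr => i _; congr (_ * _); rewrite 2![in RHS]mxE.
rewrite vA [in leRHS](vE x) !(normU P) // mulr_sumr ler_sum // => i _.
rewrite vD normrM exprMn mulrC.
have [xi0|xi0] := eqVneq (v x 0 i) 0; first by rewrite xi0 normr0 expr0n !mulr0.
rewrite ler_wpM2r ?exprn_ge0 //.
suff : root q (D 0 i).
  by move=> /qlam qi; rewrite lerXn2r ?nnegrE ?(le_trans _ qi).
have prodE : ('X - d%:P) * q = ('X - (D 0 i)%:P) * \prod_(j | j != i) ('X - (D 0 j)%:P).
  by rewrite -charA charE (bigD1 i).
(* If [d] is not a root of [q], it is a simple eigenvalue, so [u] spans its eigenspace and the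
   component of [x] along it vanishes. *)
have [Di|Di] := eqVneq (D 0 i) d; last first.
  have /(congr1 (fun p => root p (D 0 i))) := prodE.
  by rewrite !rootM !root_XsubC eqxx (negbTE Di).
move: prodE; rewrite Di => /(mulfI (negbT (polyXsubC_eq0 d))) ->.
apply/negPn/negP => /rootP/eqP; rewrite horner_prod prodf_seq_neq0 => /allP nD.
have uj j : j != i -> v u 0 j = 0.
  move=> ji; apply/eqP/negPn/negP => /vu Dj.
  by have := nD j (mem_index_enum _); rewrite ji hornerXsubC Dj subrr eqxx.
move: vxu; rewrite (bigD1 i) //= big1 ?addr0 => [/eqP|j /uj->]; last by rewrite conjC0 mulr0.
rewrite mulf_eq0 (negbTE xi0) conjC_eq0 => /eqP ui.
case/eqP: u0; rewrite (vE u) (_ : v u = 0) ?mul0mx //.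
by apply/rowP => j; rewrite [RHS]mxE; have [->|/uj] := eqVneq j i.
Qed.

Section RealSymmetric.
Context (R : rcfType) (n : nat) (A : 'M[R]_n).
Hypothesis A_sym : A^T = A.
Local Notation toC := (map_mx (real_complex R)).

Lemma map_real_hermitian : toC A \is hermsymmx.
Proof.
apply: realsym_hermsym.
  by apply/is_hermitianmxP; rewrite scale1r map_mx_id // map_trmx A_sym.
by apply/mxOverP => i j; rewrite mxE complex_real.
Qed.

(** Hermitian eigenvalues are real, so a bound on the real roots of [q] controls all its complex
    roots. This lets the complex bound descend to real matrices. *)
Lemma root_char_poly_real (z : R[i]) :
  root (map_poly (real_complex R) (char_poly A)) z -> exists r : R, z = (r%:C)%C.
Proof.
rewrite map_char_poly (char_poly_spectral map_real_hermitian) /root horner_prod.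
rewrite prodf_seq_eq0 => /hasP[i _] /=; rewrite hornerXsubC subr_eq0 => /eqP->.
apply/complex_realP.
by have /mxOverP/(_ 0 i) := hermitian_spectral_diag_real map_real_hermitian.
Qed.

Lemma symmetric_quotient_bound (d lam : R) (q : {poly R}) (u x : 'rV[R]_n) :
  char_poly A = ('X - d%:P) * q -> (forall z, root q z -> `|z| <= lam) ->
  u != 0 -> u *m A = d *: u -> x *m u^T = 0 ->
  \sum_i (x *m A) 0 i ^+ 2 <= lam ^+ 2 * \sum_i x 0 i ^+ 2.
Proof.
move=> charA qlam u0 uA xu.
have sqE (y : 'rV[R]_n) :
    \sum_i `|toC y 0 i| ^+ 2 = ((\sum_i y 0 i ^+ 2)%:C)%C.
  rewrite rmorph_sum; apply: eq_bigr => i _.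
  by rewrite mxE normc_def /= expr0n addr0 sqrtr_sqr -rmorphXn /= real_normK ?num_real.
have charAC : char_poly (toC A) = ('X - ((d%:C)%C)%:P) * map_poly (real_complex R) q.
  by rewrite -map_char_poly charA rmorphM /= map_polyXsubC.
rewrite -lecR rmorphM rmorphXn /= -!sqE map_mxM.
apply: (hermitian_quotient_bound map_real_hermitian charAC (u := toC u)).
- move=> z qz; have [|r zr] := @root_char_poly_real z.
    by rewrite charA rmorphM rootM qz orbT.
  move: qz; rewrite zr fmorph_root => /qlam.
  by rewrite normc_def /= expr0n addr0 sqrtr_sqr lecR.
- by rewrite map_mx_eq0.
- by rewrite -map_mxM uA map_mxZ.
apply/matrixP => i j; have /matrixP/(_ i j) := xu; rewrite !mxE => xuij.
transitivity (((\sum_k x i k * u^T k j)%:C)%C); last by rewrite xuij.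
rewrite rmorph_sum; apply: eq_bigr => k _.
by rewrite !mxE rmorphM /= conj_Creal // complex_real.
Qed.

(** [q] has degree [n - 1 > 0], hence a complex root; this root is real, and its absolute value is
    at most [lam]. *)
Lemma symmetric_quotient_bound_ge0 (d lam : R) (q : {poly R}) :
  (1 < n)%N -> char_poly A = ('X - d%:P) * q ->
  (forall z, root q z -> `|z| <= lam) -> 0 <= lam.
Proof.
move=> n1 charA qlam.
have q0 : q != 0.
  by apply: contra_eq_neq charA => ->; rewrite mulr0 monic_neq0 ?char_poly_monic.
have /closed_rootP[z qz] : size (map_poly (real_complex R) q) != 1%N.
  rewrite size_map_poly; apply: contraL n1 => /eqP sq.
  have := size_char_poly A; rewrite charA size_mul ?polyXsubC_eq0 //.
  by rewrite size_XsubC sq => -[<-].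
have [|r zr] := @root_char_poly_real z; first by rewrite charA rmorphM rootM qz orbT.
by move: qz; rewrite zr fmorph_root => /qlam; apply: le_trans.
Qed.

End RealSymmetric.

End Spectral.

(** Cauchy-Schwarz: the quadratic [\sum_i (t * a i - b i) ^+ 2] in [t] is nonnegative, in particular
    at its minimum [t = S / X]. *)
Lemma sqr_sum_mul_le (R : realFieldType) (I : finType) (a b : I -> R) :
  (\sum_i a i * b i) ^+ 2 <= (\sum_i a i ^+ 2) * (\sum_i b i ^+ 2).
Proof.
set S := \sum_i a i * b i; set X := \sum_i a i ^+ 2; set Y := \sum_i b i ^+ 2.
have X0 : 0 <= X by apply: sumr_ge0 => i _; rewrite sqr_ge0.
have quad t : 0 <= t ^+ 2 * X - 2 * t * S + Y.
  have -> : t ^+ 2 * X - 2 * t * S + Y = \sum_i (t * a i - b i) ^+ 2.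
    rewrite !mulr_sumr -sumrB -big_split /=; apply: eq_bigr => i _.
    by ring.
  by apply: sumr_ge0 => i _; rewrite sqr_ge0.
have [X_gt0|] := ltP 0 X; last first.
  move=> X_le0; have X_eq0 : X = 0 by apply/eqP; rewrite eq_le X_le0.
  rewrite X_eq0 mul0r /S big1 ?expr0n // => i _.
  have /eqP : X = 0 := X_eq0.
  rewrite psumr_eq0 => [|j _]; last exact: sqr_ge0.
  by move=> /allP/(_ i (mem_index_enum _))/=; rewrite sqrf_eq0 => /eqP->; rewrite mul0r.
have := quad (S / X).
have -> : (S / X) ^+ 2 * X - 2 * (S / X) * S + Y = Y - S ^+ 2 / X.
  by field; rewrite gt_eqF.
by rewrite subr_ge0 ler_pdivrMr // mulrC.
Qed.

(** * Expander mixing *)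

Section Mixing.
Context (R : realType) (n d : nat) (lam : R) (e : rel 'I_n).
Hypotheses (n_gt1 : (1 < n)%N) (e_ndl : ndl_graph d lam e).

Lemma adjmx_sym : (adjmx R e)^T = adjmx R e.
Proof. by case: e_ndl => e_sym _ _; apply/matrixP => i j; rewrite !mxE e_sym. Qed.

Lemma ndl_graph_ge0 : 0 <= lam.
Proof.
case: e_ndl => _ _ [q [charA qlam]].
exact: (symmetric_quotient_bound_ge0 adjmx_sym n_gt1 charA qlam).
Qed.

(** The indicator of [X] minus its mean is orthogonal to the all-ones eigenvector. Its image under
    the adjacency matrix, paired with the indicator of [Y], is the deviation, which Cauchy-Schwarz
    and the eigenvalue bound then control. *)
Lemma expander_mixing (X Y : {set 'I_n}) :
  ((\sum_(i in X) #|[set j in Y | e i j]|)%:R - d%:R * #|X|%:R * #|Y|%:R / n%:R) ^+ 2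
  <= lam ^+ 2 * (#|X|%:R * #|Y|%:R).
Proof.
case: e_ndl => e_sym e_reg [q [charA qlam]].
have n0 : n%:R != 0 :> R by rewrite pnatr_eq0 -lt0n ltnW.
have sum_in (Z : {set 'I_n}) : \sum_i (i \in Z)%:R = #|Z|%:R :> R.
  by rewrite -natr_sum -big_mkcond sum1_card.
have sum_e i : \sum_j (e i j)%:R = d%:R :> R.
  by rewrite -(e_reg i) -sum_in; apply: eq_bigr => j _; rewrite inE.
pose u : 'rV[R]_n := const_mx 1.
pose x : 'rV[R]_n := \row_j ((j \in X)%:R - #|X|%:R / n%:R).
have u0 : u != 0.
  apply/eqP => /matrixP/(_ 0 (Ordinal (ltnW n_gt1))); rewrite !mxE.
  by move/eqP; rewrite oner_eq0.
have uA : u *m adjmx R e = d%:R *: u.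
  apply/rowP => j; rewrite !mxE mulr1 -(sum_e j).
  by apply: eq_bigr => i _; rewrite !mxE mul1r e_sym.
have xu : x *m u^T = 0.
  apply/matrixP => i j; rewrite !mxE.
  under eq_bigr do rewrite !mxE mulr1.
  by rewrite sumrB sum_in sumr_const card_ord -[_ *+ n]mulr_natr divfK ?subrr.
have x2 : \sum_i x 0 i ^+ 2 <= #|X|%:R.
  have -> : \sum_i x 0 i ^+ 2 = #|X|%:R - #|X|%:R ^+ 2 / n%:R.
    transitivity (\sum_i ((1 - 2 * (#|X|%:R / n%:R)) * (i \in X)%:R
        + (#|X|%:R / n%:R) ^+ 2) : R).
      by apply: eq_bigr => i _; rewrite mxE; case: (i \in X) => /=; ring.
    rewrite big_split /= -mulr_sumr sum_in sumr_const card_ord -[_ *+ n]mulr_natr.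
    by field.
  by rewrite gerBl divr_ge0 ?sqr_ge0.
have -> : (\sum_(i in X) #|[set j in Y | e i j]|)%:R - d%:R * #|X|%:R * #|Y|%:R / n%:R
    = \sum_j (x *m adjmx R e) 0 j * (j \in Y)%:R.
  under [RHS]eq_bigr do rewrite mxE mulr_suml.
  rewrite exchange_big /=.
  transitivity (\sum_i x 0 i * \sum_j (e i j && (j \in Y))%:R : R); last first.
    apply: eq_bigr => i _; rewrite mulr_sumr; apply: eq_bigr => j _.
    by rewrite [adjmx _ _ _ _]mxE -mulrA -natrM mulnb.
  under [RHS]eq_bigr do rewrite mxE mulrBl.
  rewrite sumrB -mulr_sumr exchange_big /=; congr (_ - _); last first.
    transitivity (#|X|%:R / n%:R * \sum_j d%:R * (j \in Y)%:R : R).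
      by rewrite -mulr_sumr sum_in; ring.
    congr (_ * _); apply: eq_bigr => j _; rewrite -(sum_e j) mulr_suml.
    by apply: eq_bigr => i _; rewrite -natrM mulnb e_sym.
  rewrite natr_sum big_mkcond /=; apply: eq_bigr => i _.
  case: (i \in X); rewrite ?mul0r // mul1r -sum_in.
  by apply: eq_bigr => j _; rewrite !inE andbC.
apply: le_trans (sqr_sum_mul_le _ _) _.
have -> : \sum_i (i \in Y)%:R ^+ 2 = #|Y|%:R :> R.
  by rewrite -sum_in; apply: eq_bigr => i _; case: (i \in Y); rewrite ?expr1n ?expr0n.
rewrite mulrA ler_wpM2r // (le_trans (symmetric_quotient_bound adjmx_sym charA qlam u0 uA xu)) //.
by rewrite ler_wpM2l ?sqr_ge0.
Qed.

End Mixing.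

(* The two expander mixing lemmas are combined through [t = #|C| #|B|]: the one for [G] bounds
   [t], since [C] sees few edges into [B], and the one for [F] then bounds the edges. *)
Lemma sparse_edges_le (R : realType) (n dF dG : nat) (lF lG eta : R) (F G : rel 'I_n)
    (C B : {set 'I_n}) :
  (1 < n)%N -> (0 < dF)%N -> (0 < dG)%N -> ndl_graph dF lF F -> ndl_graph dG lG G ->
  lG ^+ 2 / dG%:R ^+ 2 <= eta -> lF * lG / (dF%:R * dG%:R) <= eta ->
  (forall a, a \in C -> #|[set b in B | G a b]|%:R <= dG%:R * #|B|%:R / (2 * n%:R) :> R) ->
  (\sum_(a in C) #|[set b in B | F a b]|)%:R <= 6 * eta * (dF * n)%:R.
Proof.
move=> n1 dF0 dG0 ndlF ndlG etaG etaFG sparse.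
have n0 : 0 < n%:R :> R by rewrite ltr0n ltnW.
have dF0' : 0 < dF%:R :> R by rewrite ltr0n.
have dG0' : 0 < dG%:R :> R by rewrite ltr0n.
have lF0 := ndl_graph_ge0 n1 ndlF; have lG0 := ndl_graph_ge0 n1 ndlG.
have := expander_mixing n1 ndlF C B; have := expander_mixing n1 ndlG C B.
have : (\sum_(a in C) #|[set b in B | G a b]|)%:R
    <= dG%:R * (#|C|%:R * #|B|%:R) / (2 * n%:R) :> R.
  rewrite natr_sum; apply: le_trans (ler_sum _ sparse) _.
  by rewrite sumr_const -[leLHS]mulr_natr le_eqVlt; apply/orP; left; apply/eqP; ring.
rewrite -[dG%:R * #|C|%:R * _]mulrA -[dF%:R * #|C|%:R * _]mulrA.
have : 0 <= #|C|%:R * #|B|%:R :> R by rewrite mulr_ge0.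
move: (#|C|%:R * #|B|%:R) => t.
move: (\sum_(a in C) #|[set b in B | G a b]|)%N => eG.
move: (\sum_(a in C) #|[set b in B | F a b]|)%N => eF t0 eG_le mixG mixF.
have half : dG%:R * t / n%:R = dG%:R * t / (2 * n%:R) + dG%:R * t / (2 * n%:R) :> R.
  by field; rewrite gt_eqF.
(* Sparseness keeps the edge count of [G] at most half of its expected value [dG * t / n], so the
   deviation is at least [dG * t / (2 * n)], and mixing bounds [t]. *)
have t_le : t <= (2 * n%:R * lG / dG%:R) ^+ 2.
  have : (dG%:R * t / (2 * n%:R)) ^+ 2 <= lG ^+ 2 * t.
    have h0 : 0 <= dG%:R * t / (2 * n%:R) by rewrite divr_ge0 ?mulr_ge0 // ltW.
    have h1 : dG%:R * t / (2 * n%:R) <= dG%:R * t / n%:R - eG%:R by rewrite half; lra.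
    apply: le_trans mixG; rewrite -[leRHS]sqrrN opprB lerXn2r ?nnegrE //.
    exact: le_trans h1.
  have [->|t_neq0] := eqVneq t 0; first by rewrite sqr_ge0.
  have t_gt0 : 0 < t by rewrite lt_def t_neq0.
  have -> : (dG%:R * t / (2 * n%:R)) ^+ 2 = dG%:R ^+ 2 / (2 * n%:R) ^+ 2 * t * t :> R.
    by field; rewrite gt_eqF.
  rewrite ler_pM2r // => tle.
  have -> : (2 * n%:R * lG / dG%:R) ^+ 2 = lG ^+ 2 / (dG%:R ^+ 2 / (2 * n%:R) ^+ 2) :> R.
    by field; rewrite !gt_eqF.
  rewrite ler_pdivlMr; first by rewrite mulrC.
  by rewrite divr_gt0 ?exprn_gt0 // mulr_gt0.
have eF_le : eF%:R - dF%:R * t / n%:R <= lF * (2 * n%:R * lG / dG%:R).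
  have m0 : 0 <= lF * (2 * n%:R * lG / dG%:R).
    by rewrite mulr_ge0 // divr_ge0 ?mulr_ge0 // ltW.
  have [/ltW neg|pos] := ltP (eF%:R - dF%:R * t / n%:R) 0; first exact: le_trans neg m0.
  rewrite -ler_sqr ?nnegrE // (le_trans mixF) // exprMn.
  by rewrite ler_wpM2l ?sqr_ge0.
(* The expected count contributes [4 * eta * dF * n] and the deviation [2 * eta * dF * n], whence
   the constant 6. *)
have a1 : dF%:R * t / n%:R <= 4 * (dF * n)%:R * (lG ^+ 2 / dG%:R ^+ 2).
  have -> : 4 * (dF * n)%:R * (lG ^+ 2 / dG%:R ^+ 2)
      = dF%:R * (2 * n%:R * lG / dG%:R) ^+ 2 / n%:R.
    by rewrite natrM; field; rewrite !gt_eqF.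
  by rewrite ler_pM2r ?invr_gt0 // ler_pM2l.
have a2 : lF * (2 * n%:R * lG / dG%:R) = 2 * (dF * n)%:R * (lF * lG / (dF%:R * dG%:R)).
  by rewrite natrM; field; rewrite !gt_eqF.
have N0 : 0 <= (dF * n)%:R :> R by [].
have : 4 * (dF * n)%:R * (lG ^+ 2 / dG%:R ^+ 2) <= 4 * (dF * n)%:R * eta.
  by rewrite ler_wpM2l ?mulr_ge0.
have : 2 * (dF * n)%:R * (lF * lG / (dF%:R * dG%:R)) <= 2 * (dF * n)%:R * eta.
  by rewrite ler_wpM2l ?mulr_ge0.
rewrite -a2 => a3 a4; nra.
Qed.

(** * Counting accepted subsequences *)

Section Automaton.
Context (R : realFieldType) (T : finType) (state : Type) (U : {set T}).
Variables (ok : state -> T -> bool) (next : state -> T -> state).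

Fixpoint accepts B (l : seq T) : bool :=
  if l is x :: l' then ok B x && accepts (next B x) l' else true.

(* Subsequences are counted by position, hence with multiplicity. *)
Fixpoint accepted_count B k (l : seq T) : nat :=
  match k, l with
  | 0, _ => 1
  | _.+1, [::] => 0
  | k'.+1, x :: l' =>
      accepted_count B k l' + (if ok B x then accepted_count (next B x) k' l' else 0)
  end.

Lemma accepted_count_gt0 B m l :
  subseq m l -> accepts B m -> (0 < accepted_count B (size m) l)%N.
Proof.
elim: l m B => [|x l IHl] [|y m] B //=.
case: eqP => [->|_] sub_ml /andP[ok_y acc_m]; last first.
  by rewrite ltn_addr // (IHl (y :: m)) //= ok_y.
by rewrite ok_y ltn_addl // IHl.
Qed.

(** Nested sums, so that an induction on [N] splits off the first entry in step with
    [accepted_count]. *)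
Fixpoint seqsum N (h : seq T -> R) : R :=
  if N is N'.+1 then \sum_(x in U) seqsum N' (fun l => h (x :: l)) else h [::].

Lemma eq_seqsum N h1 h2 : h1 =1 h2 -> seqsum N h1 = seqsum N h2.
Proof.
elim: N h1 h2 => [|N IHN] h1 h2 eq_h //=.
by apply: eq_bigr => x _; apply: IHN => l; apply: eq_h.
Qed.

Lemma seqsumD N h1 h2 : seqsum N (fun l => h1 l + h2 l) = seqsum N h1 + seqsum N h2.
Proof.
by elim: N h1 h2 => [|N IHN] h1 h2 //=; rewrite -big_split /=; apply: eq_bigr => x _.
Qed.

Lemma seqsum_const N c : seqsum N (fun=> c) = #|U|%:R ^+ N * c.
Proof.
elim: N => [|N IHN] /=; first by rewrite mul1r.
by rewrite sumr_const IHN -[LHS]mulr_natl mulrA exprS.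
Qed.

(** Averaging, one entry at a time: if every first entry had a tail sum of at least its share, the
    whole sum would be too large. *)
Lemma seqsum_lt N h c : seqsum N h < #|U|%:R ^+ N * c ->
  exists l, [/\ size l = N, {subset l <= U} & h l < c].
Proof.
elim: N h => [|N IHN] h /=; first by rewrite mul1r => ?; exists [::].
rewrite exprS -mulrA => lt_sum.
have [/existsP[x /andP[Ux lt_x]]|/existsPn ge_all] := boolP
    [exists x, (x \in U) && (seqsum N (fun l => h (x :: l)) < #|U|%:R ^+ N * c)].
  have [l [szl lU hl]] := IHN _ lt_x; exists (x :: l); split => //=.
    by rewrite szl.
  by move=> y /[!inE] /predU1P[->//|/lU].
move: lt_sum; rewrite ltNge => /negP[].
rewrite mulr_natl -sumr_const ler_sum // => x Ux.
by have := ge_all x; rewrite Ux /= -leNgt.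
Qed.

Variables (Phi : state -> R) (theta : R).
Hypotheses (Phi_ge1 : forall B, 1 <= Phi B) (theta_ge0 : 0 <= theta).
Hypothesis Phi_step : forall B,
  \sum_(x in U | ok B x) Phi (next B x) <= theta * #|U|%:R * Phi B.

(** [Phi] is a potential for the number of ways to continue. In the inductive step, skipping the
    first entry accounts for ['C(N, k.+1)], taking it accounts for ['C(N, k)] at the cost granted by
    [Phi_step], and Pascal's rule adds the two. *)
Lemma seqsum_accepted_count_le N k B :
  seqsum N (fun l => (accepted_count B k l)%:R)
  <= #|U|%:R ^+ N * ('C(N, k)%:R * theta ^+ k * Phi B).
Proof.
have Phi_ge0 B' : 0 <= Phi B' by apply: le_trans (Phi_ge1 B').
elim: N k B => [|N IHN] [|k] B.
- by rewrite /= !mul1r.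
- by rewrite /= bin0n !(mulr0, mul0r).
- rewrite (@eq_seqsum _ _ (fun=> 1)) => [|l]; last by case: l.
  by rewrite seqsum_const ler_wpM2l ?exprn_ge0 // bin0 !mul1r.
rewrite /=; under eq_bigr do under eq_seqsum do rewrite natrD.
under eq_bigr do rewrite seqsumD.
rewrite big_split /= sumr_const -[X in X + _]mulr_natl binS natrD.
set D := #|U|%:R.
have bound1 := ler_wpM2l (ler0n R #|U|) (IHN k.+1 B).
have bound2 : \sum_(x in U) seqsum N (fun l =>
      (if ok B x then accepted_count (next B x) k l else 0)%:R)
    <= D ^+ N * ('C(N, k)%:R * theta ^+ k) * (theta * D * Phi B).
  apply: (@le_trans _ _ (\sum_(x in U | ok B x)
      D ^+ N * ('C(N, k)%:R * theta ^+ k) * Phi (next B x))); last first.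
    by rewrite -mulr_sumr ler_wpM2l // !mulr_ge0 ?exprn_ge0.
  rewrite [leRHS]big_mkcondr /=; apply: ler_sum => x _.
  case: (ok B x); last by rewrite seqsum_const mulr0.
  by rewrite -mulrA IHN.
apply: le_trans (lerD bound1 bound2) _.
rewrite le_eqVlt; apply/orP; left; apply/eqP.
by rewrite -/D ![_ ^+ _.+1]exprS; ring.
Qed.

(** First moment: the mean number of accepted subsequences of length [k] is below 1, so some
    sequence has none. *)
Lemma exists_seq_avoiding N k B :
  (0 < #|U|)%N -> 'C(N, k)%:R * theta ^+ k * Phi B < 1 ->
  exists l, [/\ size l = N, {subset l <= U} &
    forall m, subseq m l -> size m = k -> ~~ accepts B m].
Proof.
move=> U0 small.
have [|l [szl lU cnt_l]] := @seqsum_lt N (fun l => (accepted_count B k l)%:R) 1.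
  by rewrite (le_lt_trans (seqsum_accepted_count_le N k B)) // ltr_pM2l // exprn_gt0 // ltr0n.
exists l; split => // m sub_ml szm; apply/negP => /(accepted_count_gt0 sub_ml).
by rewrite szm; move: cnt_l; rewrite ltrn1; case: accepted_count.
Qed.

End Automaton.

(** * The Ramsey graph of a sequence of edges *)

Lemma not_ramsey_prop_lt s k N : (1 < s)%N -> (N < k)%N -> ~ ramsey_prop s k N.
Proof.
move=> s_gt1 ltNk /(_ (fun _ _ => false)) []// S [[cardS clS]|[cardS _]]; last first.
  by have := max_card (mem S); rewrite cardS card_ord leqNgt ltNk.
have /card_gt1P[x [y [xS yS xy]]] : (1 < #|S|)%N by rewrite cardS.
by have := clS x y xS yS xy.
Qed.

(* The state of the automaton is the set of vertices still allowed as second endpoints. *)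
Definition allowed n (B : {set 'I_n}) (x : 'I_n * 'I_n) := x.2 \in B.

Definition next_allowed n (G : rel 'I_n) (B : {set 'I_n}) (x : 'I_n * 'I_n) :=
  B :\: [set b | G x.1 b].

(** Applied to an independent set listed by increasing index, where no first vertex is [G]-adjacent
    to a later second vertex. *)
Lemma accepts_pairwise n (G : rel 'I_n) (B : {set 'I_n}) (l : seq ('I_n * 'I_n)) :
  all (allowed B) l -> pairwise (fun x y => ~~ G x.1 y.2) l ->
  accepts (@allowed n) (next_allowed G) B l.
Proof.
elim: l B => [|x l IHl] B //= /andP[-> lB] /andP[xl pw_l].
apply: IHl => //; apply/allP => y yl; rewrite /allowed !inE (allP xl) //=.
exact: (allP lB).
Qed.

Section RamseyGraph.
Context (n N : nat) (G : rel 'I_n) (f : 'I_N -> 'I_n * 'I_n).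

Definition ramsey_graph : rel 'I_N := fun i j =>
  ((i < j)%N && G (f i).1 (f j).2) || ((j < i)%N && G (f j).1 (f i).2).

Lemma ramsey_graph_irr : irreflexive ramsey_graph.
Proof. by move=> i; rewrite /ramsey_graph ltnn. Qed.

Lemma ramsey_graph_sym : symmetric ramsey_graph.
Proof. by move=> i j; rewrite /ramsey_graph orbC. Qed.

Lemma ramsey_graph_lt (i j : 'I_N) : (i < j)%N -> ramsey_graph i j = G (f i).1 (f j).2.
Proof. by move=> ij; rewrite /ramsey_graph ij ltnNge ltnW //= orbF. Qed.

Lemma pairwise_enum_lt (S : {set 'I_N}) : pairwise (fun i j : 'I_N => i < j)%N (enum S).
Proof.
rewrite -sorted_pairwise; last by move=> ? ? ?; apply: ltn_trans.
rewrite [enum S]/(filter _ _) sorted_filter //; first by move=> ? ? ?; apply: ltn_trans.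
by rewrite -enumT -(sorted_map (f := @nat_of_ord N) (e' := ltn)) val_enum_ord iota_ltn_sorted.
Qed.

(** Listed by increasing index, the pairs of a clique of size [s] form the configuration that
    [Hs_free] forbids. *)
Lemma ramsey_graph_clique s (F : rel 'I_n) (S : {set 'I_N}) :
  (forall i, F (f i).1 (f i).2) -> Hs_free s F G -> #|S| = s ->
  {in S &, forall x y, x != y -> ramsey_graph x y} -> False.
Proof.
move=> fF free cardS clS; apply: free; move: (esym cardS) => cardS'.
pose t (i : 'I_s) : 'I_N := enum_val (cast_ord cardS' i).
exists (fun i => (f (t i)).1), (fun i => (f (t i)).2); split => // i j ij.
have tij : (t i < t j)%N.
  have [x0 _] : exists x0 : 'I_N, x0 \in S by exists (t i); apply: enum_valP.
  rewrite /t !(enum_val_nth x0) /=.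
  by move/(pairwiseP x0): (pairwise_enum_lt S); apply; rewrite // inE -cardE cardS.
rewrite -ramsey_graph_lt //; apply: clS; rewrite ?enum_valP //.
by apply: contraTneq tij => ->; rewrite ltnn.
Qed.

End RamseyGraph.

Lemma not_ramsey_prop (R : realFieldType) n s k N (F G : rel 'I_n)
    (Phi : {set 'I_n} -> R) (theta : R) (U := [set x | F x.1 x.2]) :
  Hs_free s F G -> (0 < #|U|)%N -> (forall B, 1 <= Phi B) -> 0 <= theta ->
  (forall B : {set 'I_n}, \sum_(x in U | allowed B x) Phi (next_allowed G B x)
    <= theta * #|U|%:R * Phi B) ->
  'C(N, k)%:R * theta ^+ k * Phi setT < 1 ->
  ~ ramsey_prop s k N.
Proof.
move=> free U0 Phi_ge1 theta0 Phi_step small.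
have [l [szl lU avoid]] := exists_seq_avoiding Phi_ge1 theta0 Phi_step U0 small.
have [x0 _] : exists x0, x0 \in U by apply/card_gt0P.
pose f (i : 'I_N) := nth x0 l i.
move=> /(_ (ramsey_graph G f) (@ramsey_graph_irr _ _ G f) (@ramsey_graph_sym _ _ G f)).
case=> S [[cardS clS]|[cardS indS]].
  apply: (ramsey_graph_clique _ free cardS clS) => i.
  by have /lU : f i \in l by [rewrite mem_nth ?szl]; rewrite inE.
(* With [l] the image of the increasing enumeration of all indices, the pairs indexed by [S] form a
   subsequence of [l]. *)
have l_eq : l = map f (enum 'I_N).
  by rewrite -[LHS](mkseq_nth x0) szl /mkseq -val_enum_ord -map_comp.
suff /negP[] : ~~ accepts (@allowed n) (next_allowed G) setT (map f (enum S)).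
  apply: accepts_pairwise; first by apply/allP => x _; rewrite /allowed inE.
  rewrite pairwise_map.
  apply: (sub_in_pairwise (P := mem S)) (pairwise_enum_lt S) => [i j /= iS jS ij|].
    rewrite -(ramsey_graph_lt G f ij); apply: indS => //.
    by apply: contraTneq ij => ->; rewrite ltnn.
  by apply/allP => i; rewrite mem_enum.
apply: avoid; last by rewrite size_map -cardE.
rewrite l_eq map_subseq // [enum 'I_N]enumT; exact: filter_subseq.
Qed.

(** * Bounding the number of independent sets *)

Lemma card_edges n (F : rel 'I_n) (C B : {set 'I_n}) :
  #|[set x : 'I_n * 'I_n | F x.1 x.2 && ((x.1 \in C) && (x.2 \in B))]|
  = (\sum_(a in C) #|[set b in B | F a b]|)%N.
Proof.
rewrite -sum1_card; under [RHS]eq_bigr do rewrite -sum1_card.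
rewrite pair_big_dep /=; apply: eq_bigl => -[a b]; rewrite !inE /=.
by rewrite andbC -andbA.
Qed.

Lemma card_edges_regular n d (F : rel 'I_n) :
  regular F d -> #|[set x : 'I_n * 'I_n | F x.1 x.2]| = (d * n)%N.
Proof.
move=> F_reg; transitivity (\sum_(a in [set: 'I_n]) #|[set b in setT | F a b]|)%N.
  by rewrite -card_edges; apply: eq_card => x; rewrite !inE !andbT.
rewrite (eq_bigr (fun=> d)) => [|a _]; first by rewrite sum_nat_const cardsT card_ord mulnC.
by rewrite -(F_reg a); apply: eq_card => b; rewrite !inE.
Qed.

(* Each non-sparse step shrinks the allowed set by the factor [1 - c], which costs a factor [rho];
   the additional factor [rho^-1] pays for the step after which the allowed set is empty. *)
Definition shrink_weight (R : realType) n (rho c : R) (B : {set 'I_n}) : R :=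
  if B == set0 then 1 else powR rho (- (1 + ln (#|B|%:R : R) / c)).

Section ShrinkWeight.
Context (R : realType) (n : nat) (rho c : R).
Hypotheses (rho_gt0 : 0 < rho) (rho_le1 : rho <= 1) (c_gt0 : 0 < c).
Local Notation weight := (@shrink_weight R n rho c).

Lemma ln_card_ge0 (B : {set 'I_n}) : B != set0 -> 0 <= ln (#|B|%:R : R).
Proof. by rewrite -card_gt0 => B0; rewrite ln_ge0 // ler1n. Qed.

Lemma shrink_weight_ge1 B : 1 <= weight B.
Proof.
rewrite /shrink_weight; case: eqP => [//|/eqP B0].
rewrite -[leLHS](powRr0 rho) ger_powR ?rho_gt0 // oppr_le0 addr_ge0 //.
by rewrite divr_ge0 ?ln_card_ge0 // ltW.
Qed.

Lemma shrink_weight_le (B B' : {set 'I_n}) : B' \subset B -> weight B' <= weight B.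
Proof.
move=> sub; have [B'0|B'0] := eqVneq B' set0.
  by rewrite {1}/shrink_weight B'0 eqxx shrink_weight_ge1.
have B0 : B != set0 by apply: contra_neq B'0 => B0; apply/eqP; rewrite -subset0 -B0.
rewrite /shrink_weight (negbTE B0) (negbTE B'0) ger_powR ?rho_gt0 // lerN2 lerD2l.
by rewrite ler_pM2r ?invr_gt0 // ler_ln ?posrE ?ltr0n ?card_gt0 // ler_nat subset_leq_card.
Qed.

(** Since [1 - c <= expR (- c)], the logarithm of the size drops by at least [c], so for nonempty
    [B'] the exponent of [rho] rises by at least one. *)
Lemma shrink_weight_shrink (B B' : {set 'I_n}) :
  B != set0 -> #|B'|%:R <= (1 - c) * #|B|%:R -> weight B' <= rho * weight B.
Proof.
move=> B0 shrink.
have -> : rho * weight B = powR rho (- (ln (#|B|%:R : R) / c)).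
  rewrite /shrink_weight (negbTE B0) opprD powRD ?(gt_eqF rho_gt0) ?implybT //.
  by rewrite powR_inv1 ?ltW // mulrA mulfV ?mul1r // gt_eqF.
have [B'0|B'0] := eqVneq B' set0.
  rewrite {1}/shrink_weight B'0 eqxx -[leLHS](powRr0 rho) ger_powR ?rho_gt0 // oppr_le0.
  by rewrite divr_ge0 ?ln_card_ge0 // ltW.
rewrite /shrink_weight (negbTE B'0) ger_powR ?rho_gt0 // lerN2.
have B_gt0 : 0 < #|B|%:R :> R by rewrite ltr0n card_gt0.
have B'_gt0 : 0 < #|B'|%:R :> R by rewrite ltr0n card_gt0.
have -> : 1 + ln (#|B'|%:R : R) / c = (c + ln (#|B'|%:R : R)) / c.
  by rewrite mulrDl mulfV ?gt_eqF.
rewrite ler_pM2r ?invr_gt0 // -ler_expR expRD !lnK ?posrE //.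
have le_c : #|B'|%:R <= expR (- c) * #|B|%:R.
  by apply: le_trans shrink _; rewrite ler_pM2r // (le_trans _ (expR_ge1Dx _)).
by rewrite -(ler_pM2l (expR_gt0 (- c))) mulrA -expRD addNr expR0 mul1r.
Qed.

End ShrinkWeight.

(** * Binomial and logarithm estimates *)

Lemma fact_ge (R : realType) k : (k%:R : R) ^+ k <= k`!%:R * 4 ^+ k.
Proof.
case: k => [|k]; first by rewrite !expr0 mulr1.
(* From [expR (- 1/2) >= 1/2] follows [expR (1/2) <= 2]; then square. *)
have e4 : expR 1 <= 4 :> R.
  have := expR_ge1Dx (- (2^-1) : R); have := expRxMexpNx_1 (2^-1 : R).
  have := expR_gt0 (2^-1 : R); have -> : expR 1 = expR 2^-1 * expR 2^-1 :> R.
    by rewrite -expRD; congr expR; field.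
  nra.
(* A single term of the exponential series at [k.+1] is at most its sum. *)
have := @expR_ge1Dxn R k.+1%:R k (ler0n _ _).
rewrite -[X in expR X]mulr1 expRM_natl => le1.
have le2 : (k.+1%:R : R) ^+ k.+1 / k.+1`!%:R <= 4 ^+ k.+1.
  apply: le_trans (le_trans _ le1) _; first by rewrite lerDr.
  by rewrite lerXn2r ?nnegrE ?expR_ge0.
by move: le2; rewrite ler_pdivrMr ?ltr0n ?fact_gt0 // mulrC.
Qed.

Lemma bin_le_expn N k : ('C(N, k) * k`! <= N ^ k)%N.
Proof.
rewrite bin_ffact; elim: k => [|k IHk]; first by rewrite ffactn0.
by rewrite ffactnSr expnSr leq_mul // leq_subr.
Qed.

Lemma bin_le (R : realType) N k : (0 < k)%N ->
  ('C(N, k)%:R : R) <= (4 * N%:R / k%:R) ^+ k.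
Proof.
move=> k0; rewrite -(ler_pM2r (_ : 0 < k`!%:R :> R)); last by rewrite ltr0n fact_gt0.
have -> : (4 * N%:R / k%:R) ^+ k * k`!%:R = N%:R ^+ k * (k`!%:R * 4 ^+ k) / k%:R ^+ k :> R.
  by rewrite !exprMn exprVn; ring.
rewrite -natrM ler_pdivlMr ?exprn_gt0 ?ltr0n // ler_pM ?exprn_ge0 ?fact_ge //.
by rewrite -natrX ler_nat bin_le_expn.
Qed.

Lemma ln_nat_ge (R : realType) n : (1 < n)%N -> 1 <= 2 * ln (n%:R : R).
Proof.
move=> n1; have ln2n : ln 2 <= ln (n%:R : R) by rewrite ler_ln ?posrE ?ltr0n ?ler_nat // ltnW.
(* The inequality [ln (1 + x) <= x] at [x = - 1/2] yields [ln 2 >= 1/2]. *)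
have : ln (2^-1 : R) <= - 2^-1.
  have := @le_ln1Dx R (- 2^-1); have -> : 1 + (- 2^-1) = 2^-1 :> R by field.
  by apply; lra.
rewrite lnV ?posrE //; lra.
Qed.

(** * The first inequality for small [eta] *)

Section Main.
Context (R : realType) (s n dF dG : nat) (lF lG eta : R) (F G : rel 'I_n).
Hypotheses (n1 : (1 < n)%N) (dF0 : (0 < dF)%N) (dG0 : (0 < dG)%N).
Hypotheses (ndlF : ndl_graph dF lF F) (ndlG : ndl_graph dG lG G) (free : Hs_free s F G).
Hypotheses (etaG : lG ^+ 2 / dG%:R ^+ 2 <= eta) (etaFG : lF * lG / (dF%:R * dG%:R) <= eta).
Hypotheses (eta0 : 0 < eta).
Let c : R := dG%:R / (2 * n%:R).
Let U := [set x : 'I_n * 'I_n | F x.1 x.2].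

(** An allowed pair with first vertex in the sparse set [C] contributes at most the weight of [B],
    and there are at most [6 * eta * #|U|] such pairs; any other allowed pair contributes at most
    [6 * eta] times that weight. The two kinds cost the same, hence the factor 2. *)
Lemma shrink_weight_step (B : {set 'I_n}) : 6 * eta <= 1 ->
  \sum_(x in U | allowed B x) shrink_weight (6 * eta) c (next_allowed G B x)
  <= 2 * (6 * eta) * #|U|%:R * shrink_weight (6 * eta) c B.
Proof.
move=> rho1; have rho0 : 0 < 6 * eta by rewrite mulr_gt0.
have n0 : 0 < n%:R :> R by rewrite ltr0n ltnW.
have c0 : 0 < c by rewrite divr_gt0 ?mulr_gt0 // ltr0n.
have w_ge0 : 0 <= shrink_weight (6 * eta) c B.
  exact: le_trans (shrink_weight_ge1 rho0 rho1 c0 B).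
have [B0|B0] := eqVneq B set0.
  rewrite big_pred0; first by rewrite !mulr_ge0 // ltW.
  move=> x.
  by rewrite /allowed B0 in_set0 andbF.
pose C := [set a | #|[set b in B | G a b]|%:R <= dG%:R * #|B|%:R / (2 * n%:R) :> R].
have step x : shrink_weight (6 * eta) c (next_allowed G B x)
    <= ((x.1 \in C)%:R + 6 * eta) * shrink_weight (6 * eta) c B.
  have [xC|] := boolP (x.1 \in C).
    apply: le_trans (shrink_weight_le rho0 rho1 c0 (subsetDl _ _)) _.
    by rewrite [leRHS]mulrDl mul1r lerDl mulr_ge0 // ltW.
  rewrite inE -ltNge add0r => dense; apply: shrink_weight_shrink => //.
  have BI : B :&: [set b | G x.1 b] = [set b in B | G x.1 b].
    by apply/setP => b; rewrite !inE.
  have /(congr1 (fun m : nat => m%:R : R)) := cardsID [set b | G x.1 b] B.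
  rewrite natrD BI -/(next_allowed G B x).
  have : c * #|B|%:R = dG%:R * #|B|%:R / (2 * n%:R) by rewrite /c; ring.
  lra.
apply: le_trans (ler_sum _ (fun x _ => step x)) _.
rewrite -mulr_suml ler_wpM2r // big_split /= -natr_sum sumr_const.
have -> : 2 * (6 * eta) * #|U|%:R = 6 * eta * #|U|%:R + 6 * eta * #|U|%:R by ring.
have F_reg : regular F dF by case: ndlF.
apply: lerD; last first.
  rewrite -[leLHS]mulr_natr ler_pM2l // ler_nat subset_leq_card //.
  by apply/subsetP => x; rewrite unfold_in => /andP[].
have -> : (\sum_(x in U | allowed B x) (x.1 \in C) = \sum_(a in C) #|[set b in B | F a b]|)%N.
  rewrite -card_edges -sum1_card [LHS]big_mkcond [RHS]big_mkcond /=.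
  apply: eq_bigr => x _; rewrite [x \in U]inE [x \in [set _ | _]]inE /allowed.
  by case: (F _ _); case: (x.2 \in B); case: (x.1 \in C).
rewrite (card_edges_regular F_reg).
apply: (sparse_edges_le n1 dF0 dG0 ndlF ndlG etaG etaFG) => a.
by rewrite inE.
Qed.

Lemma not_ramsey_prop_eta k N :
  50 * eta < 1 -> (0 < k)%N ->
  let w : R := 4 * n%:R * ln (n%:R : R) / dG%:R in
  N%:R < 1 / 50 * k%:R * powR eta ((w - k%:R) / k%:R) ->
  ~ ramsey_prop s k N.
Proof.
move=> eta50 k0 w N_lt.
have rho1 : 6 * eta <= 1 by have := eta0; lra.
have rho0 : 0 < 6 * eta by rewrite mulr_gt0.
have n0 : 0 < n%:R :> R by rewrite ltr0n ltnW.
have dG0' : 0 < dG%:R :> R by rewrite ltr0n.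
have k0' : 0 < k%:R :> R by rewrite ltr0n.
have c0 : 0 < c by rewrite divr_gt0 ?mulr_gt0 // ltr0n.
have F_reg : regular F dF by case: ndlF.
have G_reg : regular G dG by case: ndlG.
have cardU : #|U| = (dF * n)%N := card_edges_regular F_reg.
apply: (not_ramsey_prop (Phi := shrink_weight (6 * eta) c) (theta := 2 * (6 * eta)) free).
- by rewrite -/U cardU muln_gt0 dF0 ltnW.
- exact: shrink_weight_ge1.
- by rewrite mulr_ge0 // ltW.
- by move=> B; apply: shrink_weight_step.
have dGn : dG%:R <= n%:R :> R.
  by rewrite ler_nat -(G_reg (Ordinal (ltnW n1))) -[leqRHS](card_ord n) max_card.
have ln_n := ln_nat_ge R n1.
(* Here [ln n / c] is half of [w], and it is at least 1 because [dG <= n] and [2 * ln n >= 1]; so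
   the other half of [w] absorbs the summand 1. *)
have w_ge : 1 + ln (n%:R : R) / c <= w.
  have -> : ln (n%:R : R) / c = 2 * n%:R * ln (n%:R : R) / dG%:R.
    by rewrite /c; field; rewrite !gt_eqF.
  have -> : w = 2 * (2 * n%:R * ln (n%:R : R) / dG%:R) by rewrite /w; ring.
  suff : 1 <= 2 * n%:R * ln (n%:R : R) / dG%:R by lra.
  by rewrite ler_pdivlMr // mul1r; nra.
have weightT : shrink_weight (6 * eta) c [set: 'I_n] <= powR eta (- w).
  rewrite /shrink_weight ifF; last by rewrite -cards_eq0 cardsT card_ord gtn_eqF // ltnW.
  rewrite cardsT card_ord; apply: (@le_trans _ _ (powR (6 * eta) (- w))).
    by rewrite ger_powR ?rho0 // lerN2.
  have w0 : 0 <= w by apply: le_trans w_ge; rewrite addr_ge0 // divr_ge0 ?(ltW c0) //; lra.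
  have le6 : eta <= 6 * eta by have := eta0; lra.
  by rewrite !powRN lef_pV2 ?posrE ?powR_gt0 // ge0_ler_powR // nnegrE ltW.
have powk : powR eta (w / k%:R) ^+ k = powR eta w.
  by rewrite -powR_mulrn ?powR_ge0 // -powRrM divfK // gt_eqF.
(* The factor 4 of [bin_le] and [theta = 12 * eta] give [48 * eta * N / k], which the constant 1/50
   in the bound on [N] keeps below 48/50 of the right side. *)
have base : 4 * N%:R / k%:R * (2 * (6 * eta)) < powR eta (w / k%:R).
  have : (w - k%:R) / k%:R = w / k%:R - 1 by rewrite mulrBl divff ?gt_eqF.
  move: N_lt => /[swap] ->; rewrite powRD ?(gt_eqF eta0) ?implybT // powR_inv1 ?ltW // => N_lt.
  have y0 : 0 < powR eta (w / k%:R) by rewrite powR_gt0.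
  move: (powR eta (w / k%:R)) y0 N_lt => y y0 N_lt.
  have -> : 4 * N%:R / k%:R * (2 * (6 * eta)) = N%:R * (48 * eta / k%:R) by ring.
  apply: (@lt_le_trans _ _ (1 / 50 * k%:R * (y / eta) * (48 * eta / k%:R))).
    by rewrite ltr_pM2r // divr_gt0 ?mulr_gt0.
  have -> : 1 / 50 * k%:R * (y / eta) * (48 * eta / k%:R) = 48 / 50 * y.
    by field; rewrite !gt_eqF.
  by lra.
have base0 : 0 <= 4 * N%:R / k%:R * (2 * (6 * eta)).
  by rewrite mulr_ge0 ?divr_ge0 ?mulr_ge0 // ltW.
have theta0 : 0 <= 2 * (6 * eta) by rewrite mulr_ge0 // ltW.
have weight0 : 0 <= shrink_weight (6 * eta) c [set: 'I_n].
  exact: le_trans (shrink_weight_ge1 rho0 rho1 c0 _).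
apply: (@le_lt_trans _ _ ((4 * N%:R / k%:R * (2 * (6 * eta))) ^+ k * powR eta (- w))).
  rewrite ler_pM ?mulr_ge0 ?exprn_ge0 // [leRHS]exprMn ler_wpM2r ?exprn_ge0 //.
  exact: bin_le.
rewrite powRN ltr_pdivrMr ?powR_gt0 // mul1r -powk.
by rewrite ltrXn2r ?nnegrE ?powR_ge0 // -lt0n.
Qed.

End Main.

(** * Degenerate cases, large [eta] and the second inequality *)

Lemma Hs_free_gt1 s n dF dG (F G : rel 'I_n) : (0 < n)%N -> (0 < dF)%N -> (0 < dG)%N ->
  regular F dF -> regular G dG -> Hs_free s F G -> (1 < n)%N.
Proof.
case: n F G => [//|[|//]] F G _ dF0 dG0 F_reg G_reg [].
(* On a single vertex, positive degrees force a loop in both graphs, so constant tuples form the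
   forbidden configuration. *)
exists (fun=> ord0), (fun=> ord0); split=> [i|i j _].
  by move: dF0; rewrite -(F_reg ord0) => /card_gt0P[j]; rewrite inE [j]ord1.
by move: dG0; rewrite -(G_reg ord0) => /card_gt0P[k]; rewrite inE [k]ord1.
Qed.

(** For [eta >= 1/50] this makes the first bound at most [k - 1], where the empty graph suffices. *)
Lemma powR_le_inv (R : realType) (eta e : R) :
  0 < eta -> -1 <= e <= 0 -> 1 <= 50 * eta -> powR eta e <= 50.
Proof.
move=> eta0 /andP[e1 e0] eta50; have [eta_le1|eta_gt1] := leP eta 1.
  apply: (@le_trans _ _ (powR eta (-1))); first by rewrite ger_powR ?eta0.
  rewrite powR_inv1 ?(ltW eta0) // -[leRHS]invrK lef_pV2 ?posrE ?invr_gt0 //.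
  by lra.
apply: (@le_trans _ _ (powR eta 0)); first by rewrite ler_powR // ltW.
by rewrite powRr0; lra.
Qed.

(** [powR eta x] is [expR (x * ln eta)], which is at least [1 + x * ln eta], hence at least
    [1 - 2/25]. *)
Lemma powR_ge_half (R : realType) (eta x L : R) :
  0 < eta -> 0 <= x -> - (2 * L) <= ln eta -> x * L <= 1 / 25 -> 1 / 2 <= powR eta x.
Proof.
move=> eta0 x0 ln_eta xL; rewrite /powR gt_eqF //.
by apply: le_trans (expR_ge1Dx _); nra.
Qed.

Theorem theorem2p9 (R : realType) (s n : nat) (F G : rel 'I_n)
    (dF dG : nat) (lF lG : R) :
  (3 <= s)%N ->
  ndl_graph dF lF F -> ndl_graph dG lG G -> Hs_free s F G ->
  let eta : R := Num.max (lG ^+ 2 / (dG%:R ^+ 2))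
                         (lF * lG / (dF%:R * dG%:R)) in
  let w : R := 4 * n%:R * ln (n%:R : R) / dG%:R in
  (forall k : nat, (0 < k)%N ->
     w <= k%:R -> k%:R <= eta * dF%:R * n%:R ->
     ramsey_ge s k (1 / 50 * k%:R * powR eta ((w - k%:R) / k%:R) - 1)) /\
  (forall k : nat, (0 < k)%N ->
     100 * n%:R * (ln (n%:R : R)) ^+ 2 / dG%:R <= k%:R ->
     k%:R <= eta * dF%:R * n%:R ->
     ramsey_ge s k (k%:R / (100 * eta) - 1)).
Proof.
move=> s3 ndlF ndlG free eta w.
have F_reg : regular F dF by case: ndlF.
have G_reg : regular G dG by case: ndlG.
(* The chain [1 <= k <= eta * dF * n] rules out all degenerate parameters. *)
have basic k : (0 < k)%N -> k%:R <= eta * dF%:R * n%:R ->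
    [/\ 0 < eta, (0 < dF)%N, (0 < dG)%N, (1 < n)%N & 0 <= w].
  move=> k0 k_le; have prod_gt0 : 0 < eta * dF%:R * n%:R.
    by rewrite (lt_le_trans _ k_le) ?ltr0n.
  have n0 : (0 < n)%N by move: prod_gt0; case: (n) => //; rewrite mulr0 ltxx.
  have dF0 : (0 < dF)%N by move: prod_gt0; case: (dF) => //; rewrite mulr0 mul0r ltxx.
  have eta0 : 0 < eta by move: prod_gt0; rewrite !pmulr_lgt0 ?ltr0n.
  (* Division by zero yields 0, so [dG = 0] would make [eta] zero. *)
  have dG0 : (0 < dG)%N.
    move: eta0; rewrite /eta; case: (dG) => //.
    by rewrite expr0n /= mulr0 !invr0 !mulr0 maxxx ltxx.
  have n1 := Hs_free_gt1 n0 dF0 dG0 F_reg G_reg free.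
  by split => //; rewrite divr_ge0 ?mulr_ge0 ?ln_ge0 // ler1n.
have part1 k : (0 < k)%N -> w <= k%:R -> k%:R <= eta * dF%:R * n%:R ->
    ramsey_ge s k (1 / 50 * k%:R * powR eta ((w - k%:R) / k%:R) - 1).
  move=> k0 w_le k_le N ramN.
  have [eta0 dF0 dG0 n1 w0] := basic k k0 k_le; have k0' : 0 < k%:R :> R by rewrite ltr0n.
  rewrite lerBlDr leNgt; apply/negP => N_lt.
  have [eta50|eta50] := ltP (50 * eta) 1.
    apply: (not_ramsey_prop_eta n1 dF0 dG0 ndlF ndlG free _ _ eta0 eta50 k0 _ ramN).
    - by rewrite /eta le_max lexx.
    - by rewrite /eta le_max lexx orbT.
    by apply: lt_trans N_lt; rewrite ltrDl.
  apply: (not_ramsey_prop_lt _ _ ramN); first exact: ltnW.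
  rewrite -(ltr_nat R); apply: (@lt_le_trans _ _ (N%:R + 1)); first by rewrite ltrDl.
  apply: (le_trans (ltW N_lt)).
  have e_range : -1 <= (w - k%:R) / k%:R <= 0.
    by rewrite ler_pdivlMr // ler_pdivrMr // mul0r subr_le0 w_le andbT; lra.
  have := powR_le_inv eta0 e_range eta50.
  by rewrite -(ler_pM2l k0'); lra.
split=> // k k0 k_ge k_le.
have [eta0 dF0 dG0 n1 w0] := basic k k0 k_le; have k0' : 0 < k%:R :> R by rewrite ltr0n.
have L_ge := ln_nat_ge R n1.
have n0' : 0 < n%:R :> R by rewrite ltr0n ltnW.
have dG0' : 0 < dG%:R :> R by rewrite ltr0n.
have dFn : dF%:R <= n%:R :> R.
  by rewrite ler_nat -(F_reg (Ordinal (ltnW n1))) -[leqRHS](card_ord n) max_card.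
(* The assumed lower bound on [k] is exactly [25 * w * ln n]; as [ln n >= 1/2], it also yields
   [w <= k]. *)
have wL : 25 * (w * ln n%:R) <= k%:R.
  by apply: le_trans k_ge; rewrite le_eqVlt /w; apply/orP; left; apply/eqP; ring.
have w_le : w <= k%:R by nra.
(* From [1 <= k <= eta * dF * n] and [dF <= n] one gets that [eta] is at least the inverse square of
   [n]. *)
have ln_eta : - (2 * ln (n%:R : R)) <= ln eta.
  rewrite mulr_natl -lnXn // -lnV ?posrE ?exprn_gt0 // ler_ln ?posrE ?invr_gt0 ?exprn_gt0 //.
  rewrite -[leLHS]mul1r ler_pdivrMr ?exprn_gt0 //; apply: le_trans (le_trans _ k_le) _.
    by rewrite ler1n.
  by rewrite expr2 mulrA ler_pM2r // ler_pM2l.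
(* As [w / k * ln n <= 1/25], the factor [powR eta (w / k)] costs at most a factor 2, which turns
   1/50 into 1/100. *)
have half : 1 / 2 <= powR eta (w / k%:R).
  apply: (powR_ge_half eta0 _ ln_eta); first by rewrite divr_ge0 // ltW.
  by rewrite mulrAC ler_pdivrMr //; lra.
move=> N ramN; apply: le_trans (part1 k k0 w_le k_le N ramN); rewrite lerD2r.
have -> : (w - k%:R) / k%:R = w / k%:R - 1 by rewrite mulrBl divff ?gt_eqF.
rewrite powRD ?(gt_eqF eta0) ?implybT // powR_inv1 ?(ltW eta0) //.
have -> : k%:R / (100 * eta) = 1 / 50 * k%:R * (1 / 2 / eta) by field; rewrite gt_eqF.
rewrite ler_pM2l; last by lra.
by rewrite ler_pM2r ?invr_gt0.
Qed.
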